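(* Let $X=X_{r_1}\cup\cdots\cup X_{r_\ell}$, where $0<r_1<\cdots<r_\ell\le n$, in the binary Hamming scheme $\mathcal{H}(n,2)$. Suppose $X\neq X_n$. Let $k\ge2$ be an integer. Then $X$ has $e^{\mathrm{i}\zeta}(\cos\pi/4,\pm\mathrm{i}\sin\pi/4)$-revival at time $\pi/2^k$ if and only if the following conditions hold: (i) $\displaystyle\sum_{i=1}^{\ell}\binom{n-1}{r_i-1}\equiv\pm2^{k-2}\pmod{2^k}$; (ii) for all $j=1,\ldots,k-1$, $\displaystyle\sum_{i=1}^{\ell}\binom{n-1-j}{r_i-j}\equiv0\pmod{2^{k-j}}$; (iii) the phase $e^{\mathrm{i}\zeta}$ satisfies $\displaystyle\zeta+\frac{\sum_{i=1}^{\ell}\binom{n}{r_i}\pi}{2^k}\equiv\mp\frac{\pi}{4}\pmod{2\pi}$.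
   Context: The vertices of the graphs are the binary sequences of length $n$. For $0\le r\le n$, $X_r$ is the graph in which two sequences are adjacent iff their Hamming distance is $r$, and $A_r$ is its adjacency matrix; $\{A_0,\ldots,A_n\}$ is the binary Hamming scheme $\mathcal{H}(n,2)$. The graph $X_{r_1}\cup\cdots\cup X_{r_\ell}$ has adjacency matrix $A=A_{r_1}+\cdots+A_{r_\ell}$. With $U(t)=e^{-\mathrm{i}tA}$ and $\zeta$ real, ''$X$ has $e^{\mathrm{i}\zeta}(\alpha,\beta)$-revival at time $\tau$'' means $U(\tau)=e^{\mathrm{i}\zeta}(\alpha I+\beta A_n)$, where $A_n$ is the permutation matrix swapping each sequence with its complement. Convention: $\binom{a}{b}=0$ if $b<0$ or $b>a$.
   Formalization: The sign in (i) is corrected from ±2^{k-2} to ∓2^{k-2} (opposite to the revival's sign, same as in (iii)); as printed it fails for n=3, X=X_1∪X_2, k=2, where the sum is 3≡-1 mod 4 but revival at π/4 has the upper sign. *)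

(* Defs.v *)
From HB Require Import structures.
From mathcomp Require Import all_boot all_order all_algebra.
From mathcomp Require Import complex.
From mathcomp Require Import all_classical all_reals all_analysis.

Set Implicit Arguments.
Unset Strict Implicit.
Unset Printing Implicit Defensive.

Import Order.TTheory GRing.Theory Num.Theory.
Import numFieldNormedType.Exports.

Local Open Scope classical_set_scope.
Local Open Scope ring_scope.
Local Open Scope complex_scope.

(* Binomial coefficient on integers, zero unless 0 <= b <= a.  The truncated
   subtraction of nat would be wrong here: 'C(n - 1 - j, r - j) in nat equals
   1, not 0, when j exceeds both n - 1 and r. *)
Definition binz (a b : int) : int :=
  if (0 <= b) && (b <= a) then Posz 'C(`|a|%N, `|b|%N) else 0.

Definition hamming_dist (n : nat) (x y : n.-tuple bool) : nat :=
  #|[set i : 'I_n | tnth x i != tnth y i]%SET|.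

Definition hamming_graph (n r : nat) : rel (n.-tuple bool) :=
  fun x y => hamming_dist x y == r.

Definition hamming_union (n l : nat) (r : 'I_l -> nat) : rel (n.-tuple bool) :=
  fun x y => [exists i : 'I_l, hamming_graph (r i) x y].

(* Rows and columns are indexed by the vertices through enum_val. *)
Definition adjmx (R : realType) (T : finType) (e : rel T) : 'M[R[i]]_#|T| :=
  \matrix_(x, y) (e (enum_val x) (enum_val y))%:R.

(* Entrywise sum of the exponential series; R[i]^o is R[i] with the topology
   of its modulus. *)
Definition expmx (R : realType) (m : nat) (M : 'M[R[i]]_m) : 'M[R[i]]_m :=
  \matrix_(x, y)
    limn (fun N : nat => (\sum_(k < N) (k`!%:R^-1 *: M ^+ k)) x y : R[i]^o).

Definition transition_mx (R : realType) (T : finType) (e : rel T) (t : R)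
  : 'M[R[i]]_#|T| :=
  expmx ((- ('i * t%:C)) *: adjmx R e).

Definition expi (R : realType) (zeta : R) : R[i] := cos zeta +i* sin zeta.

Definition has_revival (R : realType) (n : nat) (e : rel (n.-tuple bool))
    (zeta : R) (alpha beta : R[i]) (tau : R) : Prop :=
  transition_mx e tau =
    expi zeta *: (alpha *: 1%:M + beta *: adjmx R (@hamming_graph n n)).

Definition eqmodr (R : realType) (m x y : R) : Prop :=
  exists q : int, x - y = q%:~R * m.

Lemma adjmx_hamming_union (R : realType) (n l : nat) (r : 'I_l -> nat) :
  {homo r : i j / (i < j)%N} ->
  adjmx R (hamming_union (n := n) r) =
    \sum_(i < l) adjmx R (@hamming_graph n (r i)).
Proof.
move=> rlt; apply/matrixP => x y; rewrite summxE mxE.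
under eq_bigr do rewrite mxE.
rewrite /hamming_union; case: existsP => [[i ri]|nr]; last first.
  rewrite big1 // => i _; case: (boolP (hamming_graph _ _ _)) => // ri.
  by case: nr; exists i.
rewrite (bigD1 i) //= ri big1 ?addr0 // => j ji.
case: (boolP (hamming_graph (r j) _ _)) => // rj.
have e : r i = r j by rewrite -(eqP ri) -(eqP rj).
by case: (ltngtP i j) ji => [/rlt|/rlt|/val_inj ->]; rewrite ?e ?ltnn ?eqxx.
Qed.

(* Main.v *)
Require Import Defs.
From HB Require Import structures.
From mathcomp Require Import all_boot all_order all_algebra.
From mathcomp Require Import complex.
From mathcomp Require Import all_classical all_reals all_analysis.
From mathcomp Require Import ring lra zify.

Import Order.TTheory GRing.Theory Num.Theory.
Import numFieldNormedType.Exports.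

Local Open Scope ring_scope.
Local Open Scope complex_scope.

(* The characters x |-> (-1)^(z . x) of the cube diagonalise A and A_n, with
   eigenvalues lambda_m = sum_i [X^(r_i)] (1 - X)^m (1 + X)^(n - m) and (-1)^m,
   m = |z|.  Comparing U(tau) with the revival matrix character by character
   gives one congruence modulo 2 pi for each m <= n.  The one for m = 0 is
   (iii); relative to it the others are congruences modulo 2^(k+1) on
   lambda_0 - lambda_m.  The case m = 1 is (i).  Together with m = 0 and m = 1,
   the remaining ones say that 2^(k+1) divides every lambda_m - lambda_(m+2),
   and expanding 1 - X = (1 + X) - 2 X there gives
   4 sum_j C(m, j) (-2)^j d_(j+1), where d_j is the sum in (ii); this system of
   divisibilities is unitriangular in the (-2)^j d_(j+1), hence (ii). *)

(** * Characters of the cube and Krawtchouk polynomials *)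

(** Sums over the cube of coordinatewise products factor; this gives both the orthogonality and the
    eigenvalues of the characters. *)
Lemma sum_tuple_prod {A : comNzRingType} {T : finType} {n : nat}
    (F : 'I_n -> T -> A) :
  \sum_(x : n.-tuple T) \prod_i F i (tnth x i) = \prod_i \sum_b F i b.
Proof.
rewrite bigA_distr_bigA /=.
rewrite (reindex (fun f : {ffun 'I_n -> T} => [tuple f i | i < n])) /=.
  by apply: eq_bigr => f _; apply: eq_bigr => i _; rewrite tnth_mktuple.
exists (fun x : n.-tuple T => [ffun i => tnth x i]) => x _.
  by apply/ffunP => i; rewrite ffunE tnth_mktuple.
by apply: eq_from_tnth => i; rewrite tnth_mktuple ffunE.
Qed.

Lemma prod_expr_card {A : comPzSemiRingType} {T : finType} (a : A) (P : pred T) :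
  \prod_i a ^+ P i = a ^+ #|[set i | P i]%SET|.
Proof.
rewrite -prodr_const [RHS]big_mkcond /=.
by apply: eq_bigr => i _; rewrite inE; case: (P i).
Qed.

Definition cube_char {n : nat} (z x : n.-tuple bool) : int :=
  \prod_i (-1) ^+ (tnth z i && tnth x i).

Definition weight {n : nat} (z : n.-tuple bool) : nat :=
  #|[set i | tnth z i]%SET|.

(** Generating polynomial of the Krawtchouk values: its coefficient at [r] is the eigenvalue of
    $A_r$ on the characters of weight [m]. *)
Definition krawtchouk (n m : nat) : {poly int} :=
  (1 - 'X) ^+ m * (1 + 'X) ^+ (n - m).

Lemma weight_le {n : nat} (z : n.-tuple bool) : (weight z <= n)%N.
Proof. by rewrite -[X in (_ <= X)%N]card_ord max_card. Qed.

(** Ensures that every [m <= n] indexes an eigenvalue that actually occurs. *)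
Lemma weight_surj (n m : nat) : (m <= n)%N ->
  exists z : n.-tuple bool, weight z = m.
Proof.
move=> mn; exists [tuple (i < m)%N | i < n].
rewrite /weight -sum1_card -[RHS]card_ord -sum1_card.
rewrite (eq_bigl (fun i : 'I_n => (i < m)%N)) => [|i].
  by rewrite big_ord_narrow.
by rewrite inE tnth_mktuple.
Qed.

Lemma cube_charC {n : nat} (z x : n.-tuple bool) :
  cube_char z x = cube_char x z.
Proof. by apply: eq_bigr => i _; rewrite andbC. Qed.

(** The sum factors over coordinates: one where [x] and [y] agree contributes 2, one where they
    differ contributes 1 - 1 = 0. *)
Lemma cube_char_orthogonal {n : nat} (x y : n.-tuple bool) :
  \sum_z cube_char z x * cube_char z y = (x == y)%:R * 2 ^+ n.
Proof.
under eq_bigr do rewrite -big_split /=.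
rewrite (sum_tuple_prod (fun i b =>
  (-1) ^+ (b && tnth x i) * (-1) ^+ (b && tnth y i))).
under eq_bigr do rewrite big_bool /= !expr0.
case: eqP => [->|/eqP xy].
  rewrite [RHS]mul1r -[in RHS](card_ord n) -prodr_const.
  by apply: eq_bigr => i _; rewrite mul1r; case: (tnth y i).
have [i xi] : exists i, tnth x i != tnth y i.
  apply/existsP; apply: contraR xy; rewrite negb_exists => /forallP h.
  by apply/eqP/eq_from_tnth => i; apply/eqP; move: (h i); rewrite negbK.
by rewrite mul0r (bigD1 i) //=; move: xi; case: (tnth x i); case: (tnth y i);
  rewrite // mul0r.
Qed.

Lemma krawtchouk_weight {n : nat} (z : n.-tuple bool) :
  krawtchouk n (weight z) = \prod_i (1 + (-1) ^+ tnth z i * 'X).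
Proof.
rewrite /krawtchouk /weight.
have -> : (n - #|[set i | tnth z i]%SET| = #|[set i | ~~ tnth z i]%SET|)%N.
  rewrite [RHS]cardsCs card_ord; congr (_ - _)%N.
  by apply: eq_card => i; rewrite !inE negbK.
rewrite -!prod_expr_card -big_split /=; apply: eq_bigr => i _.
by case: (tnth z i); rewrite /= ?expr0 ?expr1 ?mulr1 ?mul1r ?mulN1r.
Qed.

(** Marking the distance by a power of ['X] treats all the graphs $X_r$ at once and makes the sum
    multiplicative: coordinate [i] contributes $(-1)^{z_i x_i} (1 + (-1)^{z_i} X)$. *)
Lemma cube_char_eigen {n : nat} (z x : n.-tuple bool) :
  \sum_y (cube_char z y)%:P * 'X^(hamming_dist x y) =
  (cube_char z x)%:P * krawtchouk n (weight z).
Proof.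
rewrite krawtchouk_weight.
pose F i b : {poly int} :=
  ((-1) ^+ (tnth z i && b))%:P * 'X ^+ (tnth x i != b).
rewrite (eq_bigr (fun y : n.-tuple bool => \prod_i F i (tnth y i))) => [|y _].
  rewrite sum_tuple_prod /cube_char rmorph_prod -big_split /=.
  apply: eq_bigr => i _; rewrite big_bool /F /=.
  by case: (tnth z i); case: (tnth x i); rewrite /= ?expr0 ?expr1 ?polyCN; ring.
by rewrite /hamming_dist -prod_expr_card [RHS]big_split /= /cube_char rmorph_prod.
Qed.

Lemma cube_char_eigen_coef (n r : nat) (z x : n.-tuple bool) :
  \sum_y (hamming_graph r x y)%:R * cube_char z y =
  (krawtchouk n (weight z))`_r * cube_char z x.
Proof.
have := congr1 (coefp r) (cube_char_eigen z x).
rewrite /coefp /= coefCM coef_sum mulrC => <-.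
apply: eq_bigr => y _; rewrite coefCM coefXn mulrC /hamming_graph.
by rewrite eq_sym.
Qed.

(** * Coefficients of Krawtchouk polynomials and eigenvalue differences *)

Lemma coef_oneDX_exp (p i : nat) : ((1 + 'X) ^+ p : {poly int})`_i = 'C(p, i)%:Z.
Proof.
rewrite exprDn coef_sum.
under eq_bigr do rewrite expr1n mul1r coefMn coefXn.
case: (ltnP i p.+1) => ip; last first.
  rewrite bin_small ?big1 // => j _.
  by rewrite gtn_eqF ?mul0rn // (leq_trans (ltn_ord j)).
rewrite (bigD1 (Ordinal ip)) //= eqxx big1 ?addr0 ?natz // => j /negPf ji.
by rewrite eq_sym -val_eqE /= in ji *; rewrite ji mul0rn.
Qed.

Lemma coef_Xn_mul_oneDX_exp (j p r : nat) :
  ('X^j * (1 + 'X) ^+ p : {poly int})`_r = binz p%:Z (r%:Z - j%:Z).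
Proof.
rewrite coefXnM coef_oneDX_exp /binz; case: ltnP => rj.
  by case: ifP => // /andP[]; lia.
rewrite subzn //=; case: ifP => // /negbT.
by rewrite -ltNge ltz_nat => /bin_small ->.
Qed.

(* Expand [1 - X = (1 + X) - 2 X]. *)
Lemma coef_oneBX_oneDX (a m p r : nat) :
  ('X^a * ((1 - 'X) ^+ m * (1 + 'X) ^+ p) : {poly int})`_r =
  \sum_(j < m.+1) 'C(m, j)%:Z *
     ((-2) ^+ j * binz (p + (m - j))%N%:Z (r%:Z - (a + j)%N%:Z)).
Proof.
have -> : 1 - 'X = (1 + 'X) + (-2 *: 'X) :> {poly int}.
  by rewrite scaleNr scaler_nat; ring.
rewrite exprDn mulr_suml mulr_sumr coef_sum; apply: eq_bigr => j _.
rewrite -coef_Xn_mul_oneDX_exp -coefZ -natz mulr_natl -coefMn; apply: (congr1 (coefp r)).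
rewrite exprZn !mulrnAl mulrnAr -!scalerAr -!scalerAl -scalerAr; congr (_ *: _ *+ _).
by rewrite !exprD; ring.
Qed.

Definition hamming_eig {l : nat} (r : 'I_l -> nat) (n m : nat) : int :=
  \sum_(i < l) (krawtchouk n m)`_(r i).

Lemma hamming_eig0 {l} (r : 'I_l -> nat) n :
  hamming_eig r n 0 = \sum_(i < l) binz n%:Z (r i)%:Z.
Proof.
apply: eq_bigr => i _; rewrite /krawtchouk expr0 mul1r subn0.
by have := coef_Xn_mul_oneDX_exp 0 n (r i); rewrite mul1r subr0.
Qed.

(** With n = p + 1, $(1+X)^{p+1} - (1-X)(1+X)^p = 2X(1+X)^p$. *)
Lemma hamming_eig_sub1 {l} (r : 'I_l -> nat) n : (0 < n)%N ->
  hamming_eig r n 0 - hamming_eig r n 1 =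
  2 * \sum_(i < l) binz (n%:Z - 1) ((r i)%:Z - 1).
Proof.
case: n => // n _; rewrite -sumrB mulr_sumr; apply: eq_bigr => i _.
rewrite (_ : n.+1%:Z - 1 = n%:Z); last by lia.
rewrite -coef_Xn_mul_oneDX_exp -coefB mulr_natl -coefMn; apply: (congr1 (coefp (r i))).
by rewrite /krawtchouk subn0 subn1 /= exprS; ring.
Qed.

Lemma hamming_eig_sub2 {l} (r : 'I_l -> nat) n m : (m.+2 <= n)%N ->
  hamming_eig r n m - hamming_eig r n m.+2 =
  4 * \sum_(j < m.+1) 'C(m, j)%:Z * ((-2) ^+ j *
    \sum_(i < l) binz (n%:Z - 1 - j.+1%:Z) ((r i)%:Z - j.+1%:Z)).
Proof.
move=> /subnK; set p := (n - _)%N => <-.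
under eq_bigr do rewrite !mulr_sumr.
rewrite exchange_big -sumrB mulr_sumr; apply: eq_bigr => i _.
(* Here $(1+X)^2 - (1-X)^2 = 4X$; the factor X is what shifts the index from j to j + 1. *)
transitivity (4 * ('X^1 * ((1 - 'X) ^+ m * (1 + 'X) ^+ p) : {poly int})`_(r i)).
  rewrite -coefB mulr_natl -coefMn; apply: (congr1 (coefp (r i))).
  rewrite /krawtchouk addnK !addnS subSn ?leqW ?leq_addl // subSn ?leq_addl //.
  by rewrite addnK !exprS; ring.
rewrite coef_oneBX_oneDX; congr (_ * _); apply: eq_bigr => j _.
by congr (_ * (_ * binz _ _)); move: (ltn_ord j); lia.
Qed.

(** The last term of the sum for [m] is [e m] itself, so strong induction peels off one [e j] at a
    time. *)
Lemma dvdz_binomial_sums (N : nat) (d : int) (e : nat -> int) :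
  (forall m, (m < N)%N -> (d %| \sum_(j < m.+1) 'C(m, j)%:Z * e j)%Z) <->
  (forall j, (j < N)%N -> (d %| e j)%Z).
Proof.
split=> [h | h m mN]; last first.
  apply: rpred_sum => j _; apply/dvdz_mull/h.
  exact: leq_trans (ltn_ord j) mN.
elim/ltn_ind => j IH jN; have := h j jN.
rewrite big_ord_recr /= binn mul1r rpredDl //.
apply: rpred_sum => i _; apply/dvdz_mull/IH => //.
exact: ltn_trans (ltn_ord i) jN.
Qed.

Lemma krawtchouk_lead n m : (m <= n)%N -> (krawtchouk n m)`_n = (-1) ^+ m.
Proof.
move=> mn; have := coef_oneBX_oneDX 0 m (n - m) n; rewrite mul1r => ->.
(* At the top degree every binomial in the expansion is C(n - j, n - j) = 1, which leaves the
   binomial expansion of $(1-2)^m$. *)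
transitivity ((1 - 2) ^+ m : int); last by congr (_ ^+ m).
rewrite exprDn; apply: eq_bigr => j _.
rewrite expr1n mul1r -[RHS]mulr_natl; congr *%R => [|]; first by rewrite natz.
have -> : (n - m + (m - j))%N%:Z = n%:Z - j%:Z by move: (ltn_ord j); lia.
by rewrite add0n /binz lexx subzn ?(leq_trans _ mn) -1?ltnS //= binn mulr1.
Qed.

(** * The matrix exponential *)

Lemma normc_le {R : realType} (a b : R) : `|a +i* b| <= (`|a| + `|b|)%:C.
Proof.
rewrite normc_def /= lecR -[leRHS]ger0_norm ?addr_ge0 // -sqrtr_sqr.
rewrite ler_wsqrtr // sqrrD !real_normK ?num_real // -addrA lerD2l lerDr.
by rewrite mulrn_wge0 // mulr_ge0.
Qed.

Lemma cvg_complex {R : realType} (a b : nat -> R) (la lb : R) :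
  (a @ \oo --> la)%classic -> (b @ \oo --> lb)%classic ->
  ((fun N => (a N +i* b N : R[i]^o)) @ \oo --> (la +i* lb : R[i]^o))%classic.
Proof.
move=> ala blb; apply/cvgrPdist_lt => -[e e'].
(* A positive element of [R[i]] is real, so the radius has zero imaginary part. *)
rewrite ltcE /= => /andP[/eqP -> e0]; have e20 : 0 < e / 2 by apply: divr_gt0 => //; exact: ltr0n.
near=> N; apply: le_lt_trans (normc_le _ _) _.
rewrite ltcR [ltRHS]splitr ltrD //.
  by near: N; apply: cvgr_dist_lt.
by near: N; apply: cvgr_dist_lt.
Unshelve. all: by end_near. Qed.

(** Since $i^2 = -1$, the parity of [k] decides whether the term belongs to the cosine or to the
    sine series. *)
Lemma exp_coeff_imag {R : realType} (t : R) (k : nat) :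
  k`!%:R^-1 * ('i * t%:C) ^+ k = cos_coeff t k +i* sin_coeff t k.
Proof.
have ii : ('i : R[i]) ^+ 2 = -1 by exact: sqr_i.
have fC : k`!%:R^-1 = (k`!%:R^-1 : R)%:C by rewrite fmorphV rmorph_nat.
rewrite /cos_coeff /sin_coeff /= fC exprMn -rmorphXn.
rewrite -[in 'i ^+ k](odd_double_half k) exprD -mul2n exprM ii.
have -> : (-1) ^+ k./2 = ((-1) ^+ k./2 : R)%:C by rewrite rmorphXn rmorphN1.
rewrite -!exprnP.
case: (boolP (odd k)) => ok /=.
  have -> : k.-1./2 = k./2.
    by rewrite -[in LHS](odd_double_half k) ok /= doubleK.
  by apply/eqP; rewrite eq_complex /=; apply/andP; split; apply/eqP; ring.
by apply/eqP; rewrite eq_complex /=; apply/andP; split; apply/eqP; ring.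
Qed.

Lemma sum_complex {R : realType} (N : nat) (a b : nat -> R) :
  \sum_(k < N) (a k +i* b k) = (\sum_(k < N) a k) +i* (\sum_(k < N) b k).
Proof.
elim: N => [|N IH]; first by rewrite !big_ord0.
by rewrite !big_ord_recr /= IH.
Qed.

Lemma cvg_exp_imag {R : realType} (t : R) :
  ((fun N : nat => (\sum_(k < N) k`!%:R^-1 * ('i * t%:C) ^+ k) : R[i]^o)
     @ \oo --> (expi t : R[i]^o))%classic.
Proof.
under eq_fun do under eq_bigr do rewrite exp_coeff_imag.
under eq_fun do rewrite sum_complex.
have seriesE (u : nat -> R) : (fun N : nat => \sum_(k < N) u k) = series u.
  by apply/funext => N; rewrite /series /= big_mkord.
apply: cvg_complex; rewrite seriesE.
  by rewrite cos.unlock; exact: is_cvg_series_cos_coeff.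
by rewrite sin.unlock; exact: is_cvg_series_sin_coeff.
Qed.

Lemma diag_conj_exp {F : comPzRingType} {m : nat} (M P Q : 'M[F]_m)
    (d : 'I_m -> F) (k : nat) :
  P *m Q = 1%:M -> Q *m P = 1%:M ->
  M = P *m diag_mx (\row_z d z) *m Q ->
  M ^+ k = P *m diag_mx (\row_z d z ^+ k) *m Q.
Proof.
move=> PQ QP ->; elim: k => [|k IH].
  rewrite expr0; have -> : diag_mx (\row_z d z ^+ 0) = 1%:M :> 'M[F]_m.
    by apply/matrixP => i j; rewrite !mxE expr0.
  by rewrite mulmx1 PQ.
rewrite exprS IH -mulmxE !mulmxA -[_ *m Q *m P]mulmxA QP mulmx1.
rewrite -[_ *m diag_mx _ *m diag_mx _]mulmxA mulmx_diag.
by congr (_ *m diag_mx _ *m _); apply/rowP => i; rewrite !mxE exprS.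
Qed.

Lemma expmx_diag {R : realType} {m : nat} (M P Q : 'M[R[i]]_m) (t : 'I_m -> R) :
  P *m Q = 1%:M -> Q *m P = 1%:M ->
  M = P *m diag_mx (\row_z ('i * (t z)%:C)) *m Q ->
  expmx M = P *m diag_mx (\row_z expi (t z)) *m Q.
Proof.
move=> PQ QP ME; apply/matrixP => x y; rewrite !mxE.
have entry (d : 'I_m -> R[i]) :
    (P *m diag_mx (\row_z d z) *m Q) x y = \sum_z P x z * d z * Q z y.
  by rewrite mxE; apply: eq_bigr => z _; rewrite mul_mx_diag !mxE.
under eq_bigr do rewrite mul_mx_diag !mxE mulrAC.
(* Each entry of a partial sum is a fixed finite linear combination of scalar exponential partial
   sums, so the limit can be taken eigenvalue by eigenvalue. *)
transitivity (limn (fun N : nat => (\sum_z P x z * Q z y *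
    (\sum_(k < N) k`!%:R^-1 * ('i * (t z)%:C) ^+ k) : R[i]^o))).
  apply: (congr1 (fun u : nat -> R[i]^o => limn u)); apply/funext => N.
  rewrite summxE.
  under [RHS]eq_bigr do rewrite mulr_sumr.
  rewrite exchange_big; apply: eq_bigr => k _.
  rewrite mxE (diag_conj_exp _ _ _ (fun z => 'i * (t z)%:C) _ PQ QP ME) entry.
  by rewrite mulr_sumr; apply: eq_bigr => z _; ring.
apply: (@cvg_lim R[i]^o); first exact: norm_hausdorff.
apply: (@cvg_big R[i]^o) => [|z _]; first exact: add_continuous.
apply: (@cvgZl_tmp _ R[i]^o); exact: cvg_exp_imag.
Qed.

(** * Phases and congruences modulo [2 * pi] *)

Lemma expiD {R : realType} (x y : R) : expi (x + y) = expi x * expi y.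
Proof. by rewrite /expi cosD sinD; simpc; rewrite [sin x * _ + _]addrC. Qed.

Lemma expi0 {R : realType} : expi (0 : R) = 1.
Proof. by rewrite /expi cos0 sin0. Qed.

Lemma expi_neq0 {R : realType} (x : R) : expi x != 0.
Proof.
apply/eqP => x0; have /eqP := expi0 (R := R).
by rewrite -(subrr x) expiD x0 mul0r eq_sym oner_eq0.
Qed.

Lemma expi_2piz {R : realType} (q : int) : expi (q%:~R * (2 * pi) : R) = 1.
Proof.
have nat_case (n : nat) : expi (n%:R * (2 * pi) : R) = 1.
  elim: n => [|n IH]; first by rewrite mul0r expi0.
  rewrite -natr1 mulrDl mul1r expiD IH mul1r /expi mulr_natl.
  by rewrite cos2pi sin2pi.
case: q => n; first exact: nat_case.
apply: (mulIf (expi_neq0 (n.+1%:R * (2 * pi)))).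
by rewrite -expiD NegzE mulrNz mulNr addNr expi0 nat_case mul1r.
Qed.

(** Reduce to [u] in $[0, 2\pi)$. Cosine is injective on $[0, \pi]$, which settles [u <= pi];
    otherwise $2\pi - u$ lies there and would vanish, against $u < 2\pi$. *)
Lemma cos_eq1 {R : realType} (x : R) : cos x = 1 -> eqmodr (2 * pi) x 0.
Proof.
move=> cx; have pi0 := pi_gt0 R.
have dpi0 : 0 < 2 * pi :> R by rewrite mulr_gt0.
set q := Num.floor (x / (2 * pi)); exists q.
have := floor_itv (x / (2 * pi)); rewrite -/q.
rewrite ler_pdivlMr // ltr_pdivrMr // intrD (mulrDl q%:~R) mul1r => /andP[q1 q2].
set u := x - q%:~R * (2 * pi).
have cu : cos u = 1.
  have := expi_2piz (R := R) (- q); rewrite mulrNz mulNr => qz.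
  have := expiD x (- (q%:~R * (2 * pi))); rewrite qz mulr1 => -[-> _].
  exact: cx.
have u0 : 0 <= u by rewrite subr_ge0.
have u2 : u < 2 * pi by rewrite ltrBlDl.
suff : u = 0 by move/eqP; rewrite subr0 subr_eq0 => /eqP.
case: (lerP u pi) => upi.
  by apply: cos_inj; rewrite ?in_itv /= ?cos0 ?cu ?u0 ?upi ?lexx ?ltW.
have cu' : cos (2 * pi - u) = 1.
  by rewrite -cosN opprB mulr_natl -cosD2pi subrK.
have : 2 * pi - u = 0.
  by apply: cos_inj; rewrite ?cu' ?cos0 // in_itv /=; apply/andP; split; lra.
by lra.
Qed.

Lemma eq_expi {R : realType} (x y : R) :
  expi x = expi y <-> eqmodr (2 * pi) x y.
Proof.
split=> [[cxy sxy]|[q xy]].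
  have [|q] := @cos_eq1 R (x - y); first by rewrite cosB cxy sxy -!expr2 cos2Dsin2.
  by rewrite subr0; exists q.
by rewrite -(subrK y x) xy expiD expi_2piz mul1r.
Qed.

(** Used to eliminate [zeta], by subtracting the congruence for m = 0 from the others. *)
Lemma eqmodr_sub {R : realType} (M x y x0 y0 : R) : eqmodr M x0 y0 ->
  eqmodr M x y <-> eqmodr M (x - x0) (y - y0).
Proof.
case=> p xy0; split=> -[q xy].
  by exists (q - p); rewrite rmorphB mulrBl -xy -xy0; ring.
by exists (q + p); rewrite rmorphD mulrDl -xy -xy0; ring.
Qed.

(** Passes from angles that are integer multiples of a common unit [c] to integer congruences. *)
Lemma eqmodr_intr {R : realType} (c : R) (m a b : int) : c != 0 ->
  eqmodr (m%:~R * c) (a%:~R * c) (b%:~R * c) <-> (a = b %[mod m])%Z.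
Proof.
move=> c0; split=> [[q]|/eqP]; last first.
  rewrite eqz_mod_dvd => /dvdzP[q qE]; exists q.
  by rewrite -mulrBl mulrA -rmorphM -qE rmorphB.
rewrite -mulrBl mulrA => /(mulIf c0); rewrite -rmorphM -rmorphB => /intr_inj abE.
by apply/eqP; rewrite eqz_mod_dvd abE dvdz_mull.
Qed.

(** Merges the two revival coefficients into one phase; the sign moves into the angle because cosine
    is even and sine odd. *)
Lemma expi_quarter {R : realType} (s : bool) :
  (cos (pi / 4 : R))%:C + (-1) ^+ s * ('i * (sin (pi / 4))%:C) =
  expi ((-1) ^+ s * (pi / 4)).
Proof.
case: s; rewrite /= ?expr1 ?expr0 ?mulN1r ?mul1r /expi ?cosN ?sinN;
  by apply/eqP; rewrite eq_complex /=; apply/andP; split; apply/eqP; ring.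
Qed.

(** * Revival read off the spectrum *)

(** The Sylvester-Hadamard matrix, whose columns are the characters. *)
Definition cube_dft (R : realType) (n : nat) : 'M[R[i]]_#|{: n.-tuple bool}| :=
  \matrix_(x, z) (cube_char (enum_val z) (enum_val x))%:~R.

Lemma cube_dft_sqr (R : realType) (n : nat) :
  cube_dft R n *m cube_dft R n = (2 ^+ n)%:M.
Proof.
apply/matrixP => x y; rewrite !mxE.
under eq_bigr do rewrite !mxE -rmorphM [X in _ * X]cube_charC.
rewrite -rmorph_sum -(@big_enum_val _ _ _ _ _ (fun z =>
  cube_char z (enum_val x) * cube_char z (enum_val y))) /=.
rewrite cube_char_orthogonal (inj_eq enum_val_inj) rmorphM rmorph_nat rmorphXn.
by rewrite mulr_natl.
Qed.

Lemma adjmx_cube_dft (R : realType) (n r : nat) :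
  adjmx R (@hamming_graph n r) *m cube_dft R n =
  cube_dft R n *m
    diag_mx (\row_z ((krawtchouk n (weight (enum_val z)))`_r)%:~R).
Proof.
apply/matrixP => x z; rewrite mul_mx_diag !mxE.
under eq_bigr do rewrite !mxE -(rmorph_nat intr) -rmorphM.
rewrite -rmorph_sum -(@big_enum_val _ _ _ _ _ (fun y =>
  (hamming_graph r (enum_val x) y)%:R * cube_char (enum_val z) y)) /=.
by rewrite cube_char_eigen_coef mulrC rmorphM.
Qed.

(** The transition matrix and the revival matrix are diagonal in the same basis of characters, so
    they agree iff their eigenvalues do. *)
Lemma has_revivalP (R : realType) (n l : nat) (r : 'I_l -> nat)
    (zeta tau : R) (alpha beta : R[i]) : {homo r : i j / (i < j)%N} ->
  has_revival (hamming_union (n := n) r) zeta alpha beta tau <->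
  forall m, (m <= n)%N ->
    expi (- (tau * (hamming_eig r n m)%:~R)) = expi zeta * (alpha + beta * (-1) ^+ m).
Proof.
move=> r_incr; set P := cube_dft R n; pose Q := 2 ^- n *: P.
have n0 : 2 ^+ n != 0 :> R[i] by rewrite expf_neq0 ?pnatr_eq0.
have PQ : P *m Q = 1%:M.
  by rewrite -scalemxAr cube_dft_sqr scale_scalar_mx mulVf.
have QP : Q *m P = 1%:M.
  by rewrite -scalemxAl cube_dft_sqr scale_scalar_mx mulVf.
have AP : adjmx R (hamming_union (n := n) r) *m P =
    P *m diag_mx (\row_z (hamming_eig r n (weight (enum_val z)))%:~R).
  rewrite adjmx_hamming_union // mulmx_suml.
  under eq_bigr do rewrite adjmx_cube_dft.
  rewrite -mulmx_sumr; congr (_ *m _); rewrite -linear_sum; congr diag_mx.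
  apply/rowP => z; rewrite summxE !mxE rmorph_sum.
  by apply: eq_bigr => i _; rewrite mxE.
rewrite /has_revival /transition_mx.
rewrite (expmx_diag _ P Q
  (fun z => - (tau * (hamming_eig r n (weight (enum_val z)))%:~R)) PQ QP); last first.
  rewrite -[LHS]mulmx1 -PQ mulmxA -scalemxAl AP; congr (_ *m _).
  rewrite scalemxAr; congr (_ *m _); apply/matrixP => i j; rewrite !mxE.
  rewrite mulrnAr; congr (_ *+ _).
  by rewrite rmorphN rmorphM rmorph_int; ring.
have -> : expi zeta *: (alpha *: 1%:M + beta *: adjmx R (@hamming_graph n n)) =
    P *m diag_mx (\row_z (expi zeta *
      (alpha + beta * (-1) ^+ weight (enum_val z)))) *m Q.
  rewrite -[LHS]mulmx1 -PQ mulmxA; congr (_ *m _).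
  rewrite -scalemxAl mulmxDl -!scalemxAl  PQ mul1mx adjmx_cube_dft.
  rewrite !mul_mx_diag; apply/matrixP => i z; rewrite !mxE.
  by rewrite krawtchouk_lead ?weight_le // rmorphXn rmorphN1; ring.
split=> [E m mn|E]; last first.
  congr (_ *m diag_mx _ *m _); apply/rowP => z; rewrite !mxE.
  by apply: E; exact: weight_le.
have [z <-] := weight_surj n m mn.
(* Undo the conjugation and compare the diagonal entries at a vertex of weight [m]. *)
move/(congr1 (fun M => Q *m M *m P)): E.
rewrite -!mulmxA QP !mulmx1 !mulmxA QP !mul1mx.
move/matrixP => /(_ (enum_rank z) (enum_rank z)).
by rewrite !mxE eqxx !mulr1n enum_rankK.
Qed.

(** * Congruences *)

(** Of the k + 1 factors 2 required, the leading 4 supplies two and $(-2)^j$ supplies j, so [S j.+1]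
    must supply the remaining k - (j + 1). *)
Lemma hamming_eig_sub2_dvd {l : nat} (r : 'I_l -> nat) (n k : nat) : (2 <= k)%N ->
  (forall m, (m.+2 <= n)%N -> (2 ^+ k.+1 %| hamming_eig r n m - hamming_eig r n m.+2)%Z) <->
  (forall j : nat, (1 <= j <= k - 1)%N ->
        (\sum_(i < l) binz (n%:Z - 1 - j%:Z) ((r i)%:Z - j%:Z)
           = 0 %[mod 2 ^+ (k - j)])%Z).
Proof.
move=> k2.
pose S (j : nat) := \sum_(i < l) binz (n%:Z - 1 - j%:Z) ((r i)%:Z - j%:Z).
(* The upper argument n - 1 - j is negative here, so the conditions with j >= n hold trivially. *)
have S0 j : (n <= j)%N -> S j = 0.
  by move=> nj; rewrite /S big1 // => i _; rewrite /binz; case: ifP => // /andP[]; lia.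
have dvdS j : (j.+1 <= k - 1)%N ->
    (2 ^+ (k - 1) %| (-2) ^+ j * S j.+1)%Z = (2 ^+ (k - j.+1) %| S j.+1)%Z.
  move=> jk; rewrite exprNn -mulrA rpredMsign.
  rewrite (_ : (k - 1 = j + (k - j.+1))%N); last by lia.
  by rewrite exprD dvdz_mul2l // expf_neq0.
have -> : (forall j : nat, (1 <= j <= k - 1)%N -> (S j = 0 %[mod 2 ^+ (k - j)])%Z) <->
    forall j, (j < n - 1)%N -> (2 ^+ (k - 1) %| (-2) ^+ j * S j.+1)%Z.
  split=> h j jn.
    case: (leqP j.+1 (k - 1)) => jk.
      by rewrite dvdS // -[S _]subr0 -eqz_mod_dvd; apply/eqP/h.
    (* Now j >= k - 1, so the power of 2 alone is divisible enough. *)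
    rewrite exprNn -mulrA rpredMsign; apply/dvdz_mulr.
    by rewrite -(@subnK (k - 1) j) // exprD dvdz_mull.
  case: j jn => // j /= jk; case: (leqP n j.+1) => nj; first by rewrite S0.
  by apply/eqP; rewrite eqz_mod_dvd subr0 -dvdS //; apply: h; lia.
rewrite -dvdz_binomial_sums.
have dvd4 m : (m.+2 <= n)%N -> (2 ^+ k.+1 %| hamming_eig r n m - hamming_eig r n m.+2)%Z =
    (2 ^+ (k - 1) %| \sum_(j < m.+1) 'C(m, j)%:Z * ((-2) ^+ j * S j.+1))%Z.
  move=> mn; rewrite hamming_eig_sub2 // (_ : k.+1 = (2 + (k - 1))%N); last by lia.
  by rewrite exprD dvdz_mul2l.
by split=> h m mn; [rewrite -dvd4 | rewrite dvd4] ; rewrite ?h //; lia.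
Qed.

Lemma hamming_eig_congruences {l : nat} (r : 'I_l -> nat) (n k : nat) (s : bool) :
  (0 < n)%N -> (2 <= k)%N ->
  (forall m, (m <= n)%N -> (hamming_eig r n 0 - hamming_eig r n m =
     ((-1) ^+ (s (+) odd m) - (-1) ^+ s) * 2 ^+ (k - 2) %[mod 2 ^+ k.+1])%Z) <->
  (\sum_(i < l) binz (n%:Z - 1) ((r i)%:Z - 1)
         = - (-1) ^+ s * 2 ^+ (k - 2) %[mod 2 ^+ k])%Z /\
  (forall j : nat, (1 <= j <= k - 1)%N ->
        (\sum_(i < l) binz (n%:Z - 1 - j%:Z) ((r i)%:Z - j%:Z)
           = 0 %[mod 2 ^+ (k - j)])%Z).
Proof.
move=> n0 k2.
have one : (hamming_eig r n 0 - hamming_eig r n 1 =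
     ((-1) ^+ (s (+) odd 1) - (-1) ^+ s) * 2 ^+ (k - 2) %[mod 2 ^+ k.+1])%Z <->
  (\sum_(i < l) binz (n%:Z - 1) ((r i)%:Z - 1)
         = - (-1) ^+ s * 2 ^+ (k - 2) %[mod 2 ^+ k])%Z.
  rewrite hamming_eig_sub1 //.
  (* Both sides are twice an integer; cancelling the 2 lowers the modulus from $2^{k+1}$ to
     $2^k$. *)
  have -> : ((-1) ^+ (s (+) odd 1) - (-1) ^+ s) * 2 ^+ (k - 2) =
      2 * (- (-1) ^+ s * 2 ^+ (k - 2)) :> int by case: s => /=; ring.
  by split=> /eqP h; apply/eqP; move: h; rewrite !eqz_mod_dvd -mulrBr exprS
    dvdz_mul2l.
rewrite -(hamming_eig_sub2_dvd _ _ _ k2) -one.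
(* The defect [g] of the congruence vanishes at 0. As the sign term depends only on the parity of
   [m], steps of two change [g] by a difference of eigenvalues alone. *)
pose g m := hamming_eig r n 0 - hamming_eig r n m -
  ((-1) ^+ (s (+) odd m) - (-1) ^+ s) * 2 ^+ (k - 2).
have gE m : (hamming_eig r n 0 - hamming_eig r n m =
    ((-1) ^+ (s (+) odd m) - (-1) ^+ s) * 2 ^+ (k - 2) %[mod 2 ^+ k.+1])%Z <->
    (2 ^+ k.+1 %| g m)%Z.
  by split=> [/eqP|h]; [|apply/eqP]; rewrite eqz_mod_dvd.
have g2 m : g m.+2 = g m + (hamming_eig r n m - hamming_eig r n m.+2).
  by rewrite /g /= negbK; ring.
split=> [h | [/gE h1 h2] m mn].
  split=> [|m mn]; first exact: h.
  have /gE := h m.+2 mn; rewrite g2 rpredDl //.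
  by apply/gE/h; exact: ltnW (ltnW mn).
apply/gE; elim/ltn_ind: m mn => -[|[|m]] IH mn //.
  by rewrite /g addbF !subrr mul0r subrr.
rewrite g2; apply: rpredD; last exact: h2.
by apply: IH => //; exact: ltnW (ltnW mn).
Qed.

(* The upper signs correspond to s = false.  With U(t) = exp (- i t A) the sign
   in the first congruence is opposite to the sign of the revival: for n = 3
   and X = X_1 + X_2, the first sum is 3 = -1 mod 4, and
   U(pi/4) = exp (i pi/4) (cos (pi/4) I + i sin (pi/4) A_3). *)
Theorem proposition4p6 (R : realType) (n l : nat) (r : 'I_l -> nat)
    (l_gt0 : (0 < l)%N)
    (r_incr : {homo r : i j / (i < j)%N})
    (r_bounds : forall i : 'I_l, (0 < r i <= n)%N)
    (X_neq_Xn : ~ (hamming_union (n := n) r =2 @hamming_graph n n))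
    (k : nat) (k_ge2 : (2 <= k)%N) (zeta : R) (s : bool) :
  has_revival (hamming_union (n := n) r) zeta
      (cos (pi / 4))%:C ((-1) ^+ s * ('i * (sin (pi / 4))%:C)) (pi / 2 ^+ k)
  <->
  [/\ (\sum_(i < l) binz (n%:Z - 1) ((r i)%:Z - 1)
         = - (-1) ^+ s * 2 ^+ (k - 2) %[mod 2 ^+ k])%Z,
      forall j : nat, (1 <= j <= k - 1)%N ->
        (\sum_(i < l) binz (n%:Z - 1 - j%:Z) ((r i)%:Z - j%:Z)
           = 0 %[mod 2 ^+ (k - j)])%Z
    & eqmodr (2 * pi)
        (zeta + (\sum_(i < l) binz n%:Z (r i)%:Z)%:~R * pi / 2 ^+ k)
        (- (-1) ^+ s * (pi / 4))].
Proof.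
have n0 : (0 < n)%N by have /andP[r0 rn] := r_bounds (Ordinal l_gt0); exact: leq_trans rn.
(* The common unit of angle: $\pi/4 = 2^{k-2} c$ and $2\pi = 2^{k+1} c$. *)
set c : R := pi / 2 ^+ k.
have k20 : 2 ^+ k != 0 :> R by rewrite expf_neq0 ?pnatr_eq0.
have c0 : c != 0 by rewrite mulf_neq0 ?invr_eq0 // gt_eqF ?pi_gt0.
have piE : pi = 2 ^+ k * c by rewrite mulrC divfK.
have pi4 : pi / 4 = (2 ^+ (k - 2))%:~R * c :> R.
  by rewrite piE -[in 2 ^+ k](subnK k_ge2) exprD rmorphXn; field.
have pi2 : 2 * pi = (2 ^+ k.+1)%:~R * c :> R by rewrite piE mulrA rmorphXn exprS.
pose Q m := eqmodr (2 * pi) (- (c * (hamming_eig r n m)%:~R))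
                   (zeta + (-1) ^+ (s (+) odd m) * (pi / 4)).
have revQ : has_revival (hamming_union (n := n) r) zeta (cos (pi / 4))%:C
    ((-1) ^+ s * ('i * (sin (pi / 4))%:C)) c <-> forall m, (m <= n)%N -> Q m.
  (* The eigenvalue $(-1)^m$ of $A_n$ flips the sign of the quarter angle exactly when [m] is
     odd. *)
  have phase m : expi zeta * ((cos (pi / 4))%:C +
      (-1) ^+ s * ('i * (sin (pi / 4))%:C) * (-1) ^+ m) =
      expi (zeta + (-1) ^+ (s (+) odd m) * (pi / 4)).
    by rewrite expiD -expi_quarter mulrAC signr_addb signr_odd.
  rewrite has_revivalP //.
  by split=> h m mn; have := h m mn; rewrite phase; move/eq_expi.
have Q0 : Q 0 <-> eqmodr (2 * pi)
    (zeta + (\sum_(i < l) binz n%:Z (r i)%:Z)%:~R * pi / 2 ^+ k)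
    (- (-1) ^+ s * (pi / 4)).
  rewrite /Q hamming_eig0 addbF -mulrA -/c.
  by split=> -[q qE]; exists (- q); rewrite mulrNz [RHS]mulNr -qE; ring.
(* Subtracting [Q 0] cancels [zeta], leaving only integer multiples of [c]. *)
have QS m : Q 0 -> (Q m <-> (hamming_eig r n 0 - hamming_eig r n m =
    ((-1) ^+ (s (+) odd m) - (-1) ^+ s) * 2 ^+ (k - 2) %[mod 2 ^+ k.+1])%Z).
  move=> q0; rewrite /Q (eqmodr_sub _ _ _ _ _ q0) -(eqmodr_intr c) // -pi2.
  rewrite (_ : - _ - _ = (hamming_eig r n 0 - hamming_eig r n m)%:~R * c); last first.
    by rewrite rmorphB; ring.
  rewrite (_ : zeta + _ - _ =
    (((-1) ^+ (s (+) odd m) - (-1) ^+ s) * 2 ^+ (k - 2))%:~R * c) //.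
  by rewrite addbF pi4 rmorphM rmorphB !rmorph_sign; ring.
rewrite revQ; split=> [h | [hi hii /Q0 q0]].
  have q0 := h 0 (leq0n n).
  have [] := (hamming_eig_congruences r n k s n0 k_ge2).1 _ => [m mn|hi hii].
    by apply/QS => //; exact: h.
  by split=> //; exact/Q0.
move=> m mn; apply/QS => //.
exact: (hamming_eig_congruences r n k s n0 k_ge2).2.
Qed.
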